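(* Let $z(x,y)>0$ be a solution of the constant astigmatism equation $z_{yy}+(1/z)_{xx}+2=0$ on a simply connected open set, and let $\alpha,\beta,\phi_1,\phi_2$ be the associated functions defined in the context, so that $\mathcal F_1(x,y,z)=(\alpha,\beta,\phi_1)$ and $\mathcal F_2(x,y,z)=(\alpha,\beta,\phi_2)$. Then, up to adding an integer multiple of $2\pi$ to $\phi_1$ or $\phi_2$, $$\phi_2=\mathcal B^{(1)}\phi_1\qquad\text{and}\qquad \phi_1=\mathcal B^{(-1)}\phi_2 ,$$ where $\mathcal B^{(\lambda)}$ denotes the B\''acklund relation of the sine-Gordon equation with parameter $\lambda$ (see context).
   Context: Put $R_\pm=\sqrt{(z_x\pm zz_y)^2+4z^3}$. Functions $\alpha,\beta$ (unique up to additive constants) are defined by $$\alpha_x=\frac{R_+}{4z},\quad \alpha_y=\frac{R_+}{4z^2},\qquad \beta_x=\frac{R_-}{4z},\quad \beta_y=-\frac{R_-}{4z^2};$$ these systems are compatible because $z$ solves the constant astigmatism equation, and $(\alpha,\beta)$ are local coordinates. The smooth functions $\phi_1,\phi_2$ are defined, up to integer multiples of $2\pi$, by $$\cos\phi_1=\frac{z_x^2-z^2z_y^2+4z^3}{R_+R_-},\quad \sin\phi_1=\frac{4z^{5/2}z_y}{R_+R_-},\qquad \cos\phi_2=\frac{z_x^2-z^2z_y^2-4z^3}{R_+R_-},\quad \sin\phi_2=\frac{4z^{3/2}z_x}{R_+R_-},$$ and are regarded as functions of $(\alpha,\beta)$; they satisfy the sine-Gordon equation $\phi_{\alpha\beta}=\sin\phi$.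 One sets $\mathcal F_i(x,y,z)=(\alpha,\beta,\phi_i)$. For $\lambda\ne0$, the notation $\psi=\mathcal B^{(\lambda)}\phi$ means that the functions $\phi,\psi$ of $(\alpha,\beta)$ satisfy $$\left(\frac{\psi-\phi}{2}\right)_\beta=\lambda\sin\frac{\psi+\phi}{2},\qquad \left(\frac{\psi+\phi}{2}\right)_\alpha=\frac1\lambda\sin\frac{\psi-\phi}{2}$$ (a relation, not a single-valued map). *)

(* Defs.v *)
From Stdlib Require Export Reals.
From Coquelicot Require Export Coquelicot.
Open Scope R_scope.

(* Functions on a planar set U are total functions R -> R -> R whose values
   off U are irrelevant.  Every set on which derivatives are taken is open. *)

Definition dx (f : R -> R -> R) : R -> R -> R := partial_derive 1 0 f.
Definition dy (f : R -> R -> R) : R -> R -> R := partial_derive 0 1 f.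

(* [ex_diff_n f n x y] alone is a condition at the point (x, y); on an open
   set, required at all points and all orders, it is C^infinity. *)
Definition smooth_on (U : R * R -> Prop) (f : R -> R -> R) : Prop :=
  forall (n : nat) (x y : R), U (x, y) -> ex_diff_n f n x y.

Definition in01 (t : R) : Prop := 0 <= t <= 1.

(* Paths and homotopies are continuous on the whole of R or R * R and only
   their values over [0,1] are constrained; a map given on [0,1] or [0,1]^2
   extends continuously by clamping the parameters. *)
Definition path_in (U : R * R -> Prop) (g : R -> R * R) : Prop :=
  (forall t, continuous g t) /\ (forall t, in01 t -> U (g t)).

Definition path_connected (U : R * R -> Prop) : Prop :=
  forall p q, U p -> U q ->
    exists g, path_in U g /\ g 0 = p /\ g 1 = q.

Definition null_homotopic_in (U : R * R -> Prop) (g : R -> R * R) : Prop :=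
  exists H : R * R -> R * R,
    (forall st, continuous H st) /\
    (forall s t, in01 s -> in01 t -> U (H (s, t))) /\
    (forall t, in01 t -> H (0, t) = g t /\ H (1, t) = g 0) /\
    (forall s, in01 s -> H (s, 0) = g 0 /\ H (s, 1) = g 0).

Definition simply_connected (U : R * R -> Prop) : Prop :=
  path_connected U /\
  (forall g, path_in U g -> g 0 = g 1 -> null_homotopic_in U g).

Definition constant_astigmatism_on (U : R * R -> Prop) (z : R -> R -> R)
  : Prop :=
  forall x y, U (x, y) ->
    partial_derive 0 2 z x y + partial_derive 2 0 (fun u v => / z u v) x y + 2
    = 0.

Definition Rplus_z (z : R -> R -> R) (x y : R) : R :=
  sqrt ((dx z x y + z x y * dy z x y) ^ 2 + 4 * z x y ^ 3).

Definition Rminus_z (z : R -> R -> R) (x y : R) : R :=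
  sqrt ((dx z x y - z x y * dy z x y) ^ 2 + 4 * z x y ^ 3).

Definition has_partials_on (U : R * R -> Prop) (f fx fy : R -> R -> R)
  : Prop :=
  forall x y, U (x, y) ->
    is_derive (fun u => f u y) x (fx x y) /\
    is_derive (fun v => f x v) y (fy x y).

Definition is_alpha (U : R * R -> Prop) (z alpha : R -> R -> R) : Prop :=
  has_partials_on U alpha
    (fun x y => Rplus_z z x y / (4 * z x y))
    (fun x y => Rplus_z z x y / (4 * z x y ^ 2)).

Definition is_beta (U : R * R -> Prop) (z beta : R -> R -> R) : Prop :=
  has_partials_on U beta
    (fun x y => Rminus_z z x y / (4 * z x y))
    (fun x y => - (Rminus_z z x y / (4 * z x y ^ 2))).

Definition is_phi1 (U : R * R -> Prop) (z phi : R -> R -> R) : Prop :=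
  smooth_on U phi /\
  forall x y, U (x, y) ->
    cos (phi x y) =
      (dx z x y ^ 2 - z x y ^ 2 * dy z x y ^ 2 + 4 * z x y ^ 3)
      / (Rplus_z z x y * Rminus_z z x y) /\
    sin (phi x y) =
      4 * Rpower (z x y) (5 / 2) * dy z x y
      / (Rplus_z z x y * Rminus_z z x y).

Definition is_phi2 (U : R * R -> Prop) (z phi : R -> R -> R) : Prop :=
  smooth_on U phi /\
  forall x y, U (x, y) ->
    cos (phi x y) =
      (dx z x y ^ 2 - z x y ^ 2 * dy z x y ^ 2 - 4 * z x y ^ 3)
      / (Rplus_z z x y * Rminus_z z x y) /\
    sin (phi x y) =
      4 * Rpower (z x y) (3 / 2) * dx z x y
      / (Rplus_z z x y * Rminus_z z x y).

(* The transformations F_1, F_2 : (x, y, z) |-> (alpha, beta, phi_i) are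
   multivalued (additive constants in alpha and beta, multiples of 2 PI in
   phi_i), hence relations. *)
Definition F1_rel (U : R * R -> Prop) (z alpha beta phi : R -> R -> R) : Prop :=
  is_alpha U z alpha /\ is_beta U z beta /\ is_phi1 U z phi.

Definition F2_rel (U : R * R -> Prop) (z alpha beta phi : R -> R -> R) : Prop :=
  is_alpha U z alpha /\ is_beta U z beta /\ is_phi2 U z phi.

(* (alpha, beta) restricts to a bijection from the open set V contained in U
   onto the open set W, with inverse (X, Y).  Differentiability of X and Y is
   enough: when alpha and beta are smooth, X and Y are then smooth, their first
   partials being rational expressions in those of alpha and beta. *)
Definition local_chart (U : R * R -> Prop) (alpha beta : R -> R -> R)
    (V W : R * R -> Prop) (X Y : R -> R -> R) : Prop :=
  open V /\ open W /\ (forall p, V p -> U p) /\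
  (forall x y, V (x, y) ->
     W (alpha x y, beta x y) /\
     X (alpha x y) (beta x y) = x /\ Y (alpha x y) (beta x y) = y) /\
  (forall a b, W (a, b) ->
     V (X a b, Y a b) /\
     alpha (X a b) (Y a b) = a /\ beta (X a b) (Y a b) = b /\
     differentiable_pt X a b /\ differentiable_pt Y a b).

Definition local_coordinates (U : R * R -> Prop) (alpha beta : R -> R -> R)
  : Prop :=
  forall p, U p -> exists V W X Y, V p /\ local_chart U alpha beta V W X Y.

Definition in_chart (X Y f : R -> R -> R) : R -> R -> R :=
  fun a b => f (X a b) (Y a b).

(* psi = B^(lambda) phi, for functions phi, psi of (alpha, beta) in W. *)
Definition Backlund (lambda : R) (W : R * R -> Prop) (phi psi : R -> R -> R)
  : Prop :=
  forall a b, W (a, b) ->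
    is_derive (fun t => (psi a t - phi a t) / 2) b
      (lambda * sin ((psi a b + phi a b) / 2)) /\
    is_derive (fun t => (psi t b + phi t b) / 2) a
      (1 / lambda * sin ((psi a b - phi a b) / 2)).

(* The relation between functions on U regarded as functions of the local
   coordinates (alpha, beta), i.e. in every chart. *)
Definition Backlund_on (lambda : R) (U : R * R -> Prop)
    (alpha beta phi psi : R -> R -> R) : Prop :=
  forall V W X Y, local_chart U alpha beta V W X Y ->
    Backlund lambda W (in_chart X Y phi) (in_chart X Y psi).

Definition shift_2PI (k : Z) (f : R -> R -> R) : R -> R -> R :=
  fun x y => f x y + IZR k * (2 * PI).

(* Main.v *)
(* Let A and B in (0, pi) be the arguments of z_x + z z_y + 2 i z^(3/2) and
   z_x - z z_y + 2 i z^(3/2), whose moduli are R_+ and R_-.  The formulas for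
   phi_1 and phi_2 say that phi_1 = B - A and phi_2 = A + B modulo 2 pi, and by
   connectedness the multiples of 2 pi are constant; choose them so that
   phi_1 = B - A and phi_2 = A + B + 2 pi.  Inverting the Jacobian of
   (alpha, beta) shows that d/d beta is 2z/R_- times d/dx - z d/dy, and
   d/d alpha is 2z/R_+ times d/dx + z d/dy.  The constant astigmatism equation
   gives A_x - z A_y = B_x + z B_y = - sqrt z, that is A_beta = - sin B and
   B_alpha = - sin A, which are the Backlund relations; the signs are why
   phi_2 carries the extra 2 pi.
   That (alpha, beta) are local coordinates follows from the signs of their
   partial derivatives: alpha increases in x and y, while beta increases in x
   and decreases in y. *)
Require Import Defs.
From Stdlib Require Import Reals Lra Lia Ranalysis5 ClassicalEpsilon.
From Coquelicot Require Import Coquelicot.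
Open Scope R_scope.

Lemma open_locally_2d (U : R * R -> Prop) (x y : R) :
  open U -> U (x, y) -> locally_2d (fun u v => U (u, v)) x y.
Proof.
  intros HU Hxy. apply locally_2d_locally.
  apply (filter_imp U); [now intros [u v] | exact (HU _ Hxy)].
Qed.

Lemma locally_2d_open (V : R * R -> Prop) :
  (forall x y, V (x, y) -> locally_2d (fun u v => V (u, v)) x y) -> open V.
Proof.
  intros H [x y] Hxy.
  apply (filter_imp (fun p => V (fst p, snd p))); [now intros [u v] |].
  now apply (locally_2d_locally (fun u v => V (u, v))), H.
Qed.

Lemma has_partials_differentiable (U : R * R -> Prop) (f fx fy : R -> R -> R)
  (x y : R) :
  open U -> U (x, y) -> has_partials_on U f fx fy ->
  continuity_2d_pt fx x y ->
  differentiable_pt_lim f x y (fx x y) (fy x y).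
Proof.
  intros HU Hxy Hf Hc.
  apply filterdiff_differentiable_pt_lim.
  eapply filterdiff_ext_lin.
  - apply (is_derive_filterdiff f x y fx (fy x y)).
    + apply (filter_imp U); [| exact (HU _ Hxy)].
      intros [u v] Huv. apply (Hf u v Huv).
    + apply (Hf x y Hxy).
    + now apply continuity_2d_pt_filterlim.
  - reflexivity.
Qed.

Lemma differentiable_pt_lim_is_derive (f : R -> R -> R) (x y lx ly : R) :
  differentiable_pt_lim f x y lx ly ->
  is_derive (fun u => f u y) x lx /\ is_derive (fun v => f x v) y ly.
Proof.
  intros H; split; apply is_derive_Reals.
  - replace lx with (lx * 1 + ly * 0) by ring.
    apply (derivable_pt_lim_comp_2d f (fun t => t) (fun _ => y) x); trivial.
    + apply derivable_pt_lim_id.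
    + apply derivable_pt_lim_const.
  - replace ly with (lx * 0 + ly * 1) by ring.
    apply (derivable_pt_lim_comp_2d f (fun _ => x) (fun t => t) y); trivial.
    + apply derivable_pt_lim_const.
    + apply derivable_pt_lim_id.
Qed.

Lemma derive_pos_increasing (f df : R -> R) (a b : R) :
  (forall t, a <= t <= b -> is_derive f t (df t)) ->
  (forall t, a <= t <= b -> 0 < df t) -> a < b -> f a < f b.
Proof.
  intros Hd Hp Hab.
  destruct (MVT_gen f a b df) as [c [Hc Hfc]];
    rewrite ?(Rmin_left a b), ?(Rmax_right a b) in * by lra.
  - intros t Ht; apply Hd; lra.
  - intros t Ht. apply derivable_continuous_pt. exists (df t).
    now apply is_derive_Reals, Hd.
  - specialize (Hp c Hc). nra.
Qed.

Lemma derive_neg_decreasing (f df : R -> R) (a b : R) :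
  (forall t, a <= t <= b -> is_derive f t (df t)) ->
  (forall t, a <= t <= b -> df t < 0) -> a < b -> f b < f a.
Proof.
  intros Hd Hn Hab.
  apply Ropp_lt_cancel.
  apply (derive_pos_increasing (fun t => - f t) (fun t => - df t)); trivial.
  - intros t Ht. apply (is_derive_opp f t (df t)). now apply Hd.
  - intros t Ht. specialize (Hn t Ht). lra.
Qed.

Lemma continuity_2d_pt_comp_1d (f : R -> R -> R) (g h : R -> R) (t : R) :
  continuity_2d_pt f (g t) (h t) -> continuity_pt g t -> continuity_pt h t ->
  continuity_pt (fun s => f (g s) (h s)) t.
Proof.
  intros Hf Hg Hh.
  apply continuity_pt_filterlim.
  apply continuity_pt_filterlim in Hg; apply continuity_pt_filterlim in Hh.
  apply (continuous_comp_2 g h f t); trivial.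
  now apply continuity_2d_pt_filterlim.
Qed.

Lemma inverse_differentiable (f g X Y : R -> R -> R) (a b fx fy gx gy : R) :
  differentiable_pt_lim f (X a b) (Y a b) fx fy ->
  differentiable_pt_lim g (X a b) (Y a b) gx gy ->
  fx * gy - fy * gx <> 0 ->
  continuity_2d_pt X a b -> continuity_2d_pt Y a b ->
  locally_2d (fun u v => f (X u v) (Y u v) = u /\ g (X u v) (Y u v) = v) a b ->
  differentiable_pt_lim X a b
    (gy / (fx * gy - fy * gx)) (- fy / (fx * gy - fy * gx)) /\
  differentiable_pt_lim Y a b
    (- gx / (fx * gy - fy * gx)) (fx / (fx * gy - fy * gx)).
Proof.
  intros Hf Hg HD HX HY Hinv.
  set (D := fx * gy - fy * gx) in *.
  set (K := (Rabs fx + Rabs fy + Rabs gx + Rabs gy + 1) * / Rabs D).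
  assert (HaD : 0 < / Rabs D) by now apply Rinv_0_lt_compat, Rabs_pos_lt.
  assert (HK : 0 < K).
  { apply Rmult_lt_0_compat; trivial.
    pose proof (Rabs_pos fx); pose proof (Rabs_pos fy);
    pose proof (Rabs_pos gx); pose proof (Rabs_pos gy); lra. }
  assert (Hdiv : forall c1 c2 e1 e2 m,
    Rabs c1 + Rabs c2 <= Rabs fx + Rabs fy + Rabs gx + Rabs gy ->
    Rabs e1 <= m -> Rabs e2 <= m ->
    Rabs ((c1 * e1 + c2 * e2) / D) <= K * m).
  { intros c1 c2 e1 e2 m Hc H1 H2.
    unfold Rdiv, K. rewrite Rabs_mult, Rabs_inv.
    rewrite (Rmult_comm (_ * / Rabs D) m), <- Rmult_assoc.
    apply Rmult_le_compat_r; [lra |].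
    eapply Rle_trans; [apply Rabs_triang |]. rewrite !Rabs_mult.
    pose proof (Rabs_pos c1); pose proof (Rabs_pos c2);
    pose proof (Rabs_pos e1); pose proof (Rabs_pos e2). nra. }
  enough (Hmain : forall eps : posreal, locally_2d (fun u v =>
    Rabs (X u v - X a b - (gy / D * (u - a) + - fy / D * (v - b))) <=
      eps * Rmax (Rabs (u - a)) (Rabs (v - b)) /\
    Rabs (Y u v - Y a b - (- gx / D * (u - a) + fx / D * (v - b))) <=
      eps * Rmax (Rabs (u - a)) (Rabs (v - b))) a b).
  { split; intros eps; destruct (Hmain eps) as [d Hd]; exists d;
      intros u v Hu Hv; now apply (Hd u v). }
  intros eps.
  set (eta0 := Rmin (/ (2 * K)) (eps / (2 * (K * K)))).
  assert (Heta : 0 < eta0).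
  { pose proof (cond_pos eps).
    apply Rmin_pos; [apply Rinv_0_lt_compat | apply Rdiv_lt_0_compat]; nra. }
  set (eta := mkposreal eta0 Heta).
  assert (Heta1 : K * eta0 <= / 2).
  { apply Rle_trans with (K * / (2 * K)).
    - apply Rmult_le_compat_l; [lra | apply Rmin_l].
    - right; field; lra. }
  assert (Heta2 : 2 * (K * K) * eta0 <= eps).
  { apply Rle_trans with (2 * (K * K) * (eps / (2 * (K * K)))).
    - apply Rmult_le_compat_l; [nra | apply Rmin_r].
    - right; field; lra. }
  destruct (Hf eta) as [d1 H1]; destruct (Hg eta) as [d2 H2].
  assert (Hd : 0 < Rmin d1 d2) by (apply Rmin_pos; apply cond_pos).
  destruct (HX (mkposreal _ Hd)) as [r1 Hr1];
  destruct (HY (mkposreal _ Hd)) as [r2 Hr2]; destruct Hinv as [r3 Hr3].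
  assert (Hr : 0 < Rmin r1 (Rmin r2 r3)) by (repeat apply Rmin_pos; apply cond_pos).
  exists (mkposreal _ Hr). simpl in *. intros u v Hu Hv.
  pose proof (Rmin_l r1 (Rmin r2 r3)); pose proof (Rmin_r r1 (Rmin r2 r3));
  pose proof (Rmin_l r2 r3); pose proof (Rmin_r r2 r3);
  pose proof (Rmin_l d1 d2); pose proof (Rmin_r d1 d2).
  destruct (Hr3 u v) as [Ef Eg]; [lra | lra |].
  destruct (Hr3 a b) as [Ef0 Eg0];
    [rewrite Rminus_diag, Rabs_R0; apply cond_pos .. |].
  specialize (Hr1 u v ltac:(lra) ltac:(lra)).
  specialize (Hr2 u v ltac:(lra) ltac:(lra)).
  specialize (H1 (X u v) (Y u v) ltac:(lra) ltac:(lra)).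
  specialize (H2 (X u v) (Y u v) ltac:(lra) ltac:(lra)).
  rewrite Ef, Ef0 in H1; rewrite Eg, Eg0 in H2.
  set (h := X u v - X a b) in *; set (k := Y u v - Y a b) in *.
  set (m := Rmax (Rabs h) (Rabs k)) in *.
  set (n := Rmax (Rabs (u - a)) (Rabs (v - b))).
  set (e1 := u - a - (fx * h + fy * k)) in *.
  set (e2 := v - b - (gx * h + gy * k)) in *.
  assert (Hn1 : Rabs (u - a) <= n) by apply Rmax_l.
  assert (Hn2 : Rabs (v - b) <= n) by apply Rmax_r.
  assert (Ee1 : u - a = fx * h + fy * k + e1) by (unfold e1; ring).
  assert (Ee2 : v - b = gx * h + gy * k + e2) by (unfold e2; ring).
  pose proof (Rabs_pos fx); pose proof (Rabs_pos fy);
  pose proof (Rabs_pos gx); pose proof (Rabs_pos gy).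
  assert (Bh : Rabs (h - (gy / D * (u - a) + - fy / D * (v - b))) <=
               K * (eta0 * m)).
  { replace (h - (gy / D * (u - a) + - fy / D * (v - b)))
      with ((- gy * e1 + fy * e2) / D)
      by (rewrite Ee1, Ee2; unfold D; field; exact HD).
    apply Hdiv; trivial. rewrite Rabs_Ropp; lra. }
  assert (Bk : Rabs (k - (- gx / D * (u - a) + fx / D * (v - b))) <=
               K * (eta0 * m)).
  { replace (k - (- gx / D * (u - a) + fx / D * (v - b)))
      with ((gx * e1 + - fx * e2) / D)
      by (rewrite Ee1, Ee2; unfold D; field; exact HD).
    apply Hdiv; trivial. rewrite Rabs_Ropp; lra. }
  assert (Hm : m <= K * n + K * (eta0 * m)).
  { assert (Ch : Rabs (gy / D * (u - a) + - fy / D * (v - b)) <= K * n).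
    { replace (gy / D * (u - a) + - fy / D * (v - b))
        with ((gy * (u - a) + - fy * (v - b)) / D) by (field; exact HD).
      apply Hdiv; trivial. rewrite Rabs_Ropp; lra. }
    assert (Ck : Rabs (- gx / D * (u - a) + fx / D * (v - b)) <= K * n).
    { replace (- gx / D * (u - a) + fx / D * (v - b))
        with ((- gx * (u - a) + fx * (v - b)) / D) by (field; exact HD).
      apply Hdiv; trivial. rewrite Rabs_Ropp; lra. }
    apply Rmax_lub.
    - pose proof (Rabs_triang_inv h (gy / D * (u - a) + - fy / D * (v - b))). lra.
    - pose proof (Rabs_triang_inv k (- gx / D * (u - a) + fx / D * (v - b))). lra. }
  assert (Hm0 : 0 <= m)
    by (eapply Rle_trans; [apply (Rabs_pos h) | apply Rmax_l]).
  assert (Hn0 : 0 <= n)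
    by (eapply Rle_trans; [apply (Rabs_pos (u - a)) | apply Rmax_l]).
  assert (Hmn : m <= 2 * K * n) by nra.
  assert (Hfin : K * (eta0 * m) <= eps * n).
  { apply Rle_trans with (K * (eta0 * (2 * K * n))).
    - apply Rmult_le_compat_l; [lra |]. apply Rmult_le_compat_l; lra.
    - replace (K * (eta0 * (2 * K * n))) with (2 * (K * K) * eta0 * n) by ring.
      now apply Rmult_le_compat_r. }
  split; lra.
Qed.

Ltac min_le := solve
  [ apply Rle_refl
  | eapply Rle_trans; [apply Rmin_l | min_le]
  | eapply Rle_trans; [apply Rmin_r | min_le] ].

Definition opposed_monotone (f g : R -> R -> R) (x0 y0 r : R) : Prop :=
  (forall x x' y, x0 - r <= x -> x < x' -> x' <= x0 + r ->
     y0 - r <= y <= y0 + r -> f x y < f x' y /\ g x y < g x' y) /\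
  (forall x y y', x0 - r <= x <= x0 + r ->
     y0 - r <= y -> y < y' -> y' <= y0 + r -> f x y < f x y' /\ g x y' < g x y).

Lemma opposed_monotone_subsquare (f g : R -> R -> R) (x0 y0 r x1 y1 s : R) :
  x0 - r <= x1 - s -> x1 + s <= x0 + r -> y0 - r <= y1 - s -> y1 + s <= y0 + r ->
  opposed_monotone f g x0 y0 r -> opposed_monotone f g x1 y1 s.
Proof.
  intros ? ? ? ? [H1 H2]; split; intros; [apply H1 | apply H2]; lra.
Qed.

(* Equal values of f force the displacements in x and y to have opposite signs,
   equal values of g force them to have the same sign. *)
Lemma opposed_monotone_injective (f g : R -> R -> R) (x0 y0 r x y x' y' : R) :
  opposed_monotone f g x0 y0 r ->
  x0 - r <= x <= x0 + r -> y0 - r <= y <= y0 + r ->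
  x0 - r <= x' <= x0 + r -> y0 - r <= y' <= y0 + r ->
  f x y = f x' y' -> g x y = g x' y' -> x = x' /\ y = y'.
Proof.
  intros [Hx Hy] Hx1 Hy1 Hx2 Hy2 Ef Eg.
  destruct (Rtotal_order x x') as [L | [<- | L]].
  - destruct (Rtotal_order y y') as [M | [<- | M]]; exfalso.
    + pose proof (Hx x x' y ltac:(lra) L ltac:(lra) ltac:(lra)).
      pose proof (Hy x' y y' ltac:(lra) ltac:(lra) M ltac:(lra)). lra.
    + pose proof (Hx x x' y ltac:(lra) L ltac:(lra) ltac:(lra)). lra.
    + pose proof (Hx x x' y ltac:(lra) L ltac:(lra) ltac:(lra)).
      pose proof (Hy x' y' y ltac:(lra) ltac:(lra) M ltac:(lra)). lra.
  - destruct (Rtotal_order y y') as [M | [<- | M]]; [exfalso | now split | exfalso].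
    + pose proof (Hy x y y' ltac:(lra) ltac:(lra) M ltac:(lra)). lra.
    + pose proof (Hy x y' y ltac:(lra) ltac:(lra) M ltac:(lra)). lra.
  - destruct (Rtotal_order y y') as [M | [<- | M]]; exfalso.
    + pose proof (Hx x' x y ltac:(lra) L ltac:(lra) ltac:(lra)).
      pose proof (Hy x' y y' ltac:(lra) ltac:(lra) M ltac:(lra)). lra.
    + pose proof (Hx x' x y ltac:(lra) L ltac:(lra) ltac:(lra)). lra.
    + pose proof (Hx x' x y ltac:(lra) L ltac:(lra) ltac:(lra)).
      pose proof (Hy x' y' y ltac:(lra) ltac:(lra) M ltac:(lra)). lra.
Qed.

Lemma continuity_2d_pt_gt (f : R -> R -> R) (x y c : R) :
  continuity_2d_pt f x y -> c < f x y -> locally_2d (fun u v => c < f u v) x y.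
Proof.
  intros Hf Hc. assert (He : 0 < f x y - c) by lra.
  destruct (Hf (mkposreal _ He)) as [d Hd]; exists d; intros u v Hu Hv.
  specialize (Hd u v Hu Hv); simpl in Hd; apply Rabs_def2 in Hd; lra.
Qed.

Lemma continuity_2d_pt_lt (f : R -> R -> R) (x y c : R) :
  continuity_2d_pt f x y -> f x y < c -> locally_2d (fun u v => f u v < c) x y.
Proof.
  intros Hf Hc. assert (He : 0 < c - f x y) by lra.
  destruct (Hf (mkposreal _ He)) as [d Hd]; exists d; intros u v Hu Hv.
  specialize (Hd u v Hu Hv); simpl in Hd; apply Rabs_def2 in Hd; lra.
Qed.

Lemma implicit_continuous (f : R -> R -> R) (h : R -> R) (a d x0 y0 r x : R) :
  (forall x y y', x0 - d < x < x0 + d ->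
     y0 - r <= y -> y < y' -> y' <= y0 + r -> f x y < f x y') ->
  (forall x y, x0 - d < x < x0 + d -> y0 - r <= y <= y0 + r ->
     continuity_2d_pt f x y) ->
  (forall x, x0 - d < x < x0 + d -> y0 - r < h x < y0 + r /\ f x (h x) = a) ->
  x0 - d < x < x0 + d -> continuity_pt h x.
Proof.
  intros Hy Hc Hh Hx.
  destruct (Hh x Hx) as [Hhx Ea].
  apply continuity_pt_locally. intros eps.
  set (e := Rmin (eps / 2) (Rmin (h x - (y0 - r)) (y0 + r - h x))).
  pose proof (cond_pos eps).
  assert (He : 0 < e) by (repeat apply Rmin_pos; lra).
  assert (He1 : e <= eps / 2) by apply Rmin_l.
  assert (He2 : e <= h x - (y0 - r))
    by min_le.
  assert (He3 : e <= y0 + r - h x)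
    by min_le.
  pose proof (Hy x (h x - e) (h x) ltac:(lra) ltac:(lra) ltac:(lra) ltac:(lra)).
  pose proof (Hy x (h x) (h x + e) ltac:(lra) ltac:(lra) ltac:(lra) ltac:(lra)).
  assert (L1 : locally x (fun t => f t (h x - e) < a)).
  { apply (locally_2d_1d_const_y (fun u v => f u v < a)).
    apply continuity_2d_pt_lt; [apply Hc |]; lra. }
  assert (L2 : locally x (fun t => a < f t (h x + e))).
  { apply (locally_2d_1d_const_y (fun u v => a < f u v)).
    apply continuity_2d_pt_gt; [apply Hc |]; lra. }
  assert (L3 : locally x (fun t => x0 - d < t < x0 + d)).
  { apply (open_and _ _ (open_gt (x0 - d)) (open_lt (x0 + d))). exact Hx. }
  generalize (filter_and _ _ (filter_and _ _ L1 L2) L3).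
  apply filter_imp. intros t [[T1 T2] T3].
  destruct (Hh t T3) as [Hht Et].
  apply Rabs_def1.
  - apply Rle_lt_trans with e; [| lra].
    apply Rnot_lt_le; intros Hlt.
    pose proof (Hy t (h x + e) (h t) T3 ltac:(lra) ltac:(lra) ltac:(lra)). lra.
  - apply Rlt_le_trans with (- e); [lra |].
    apply Rnot_lt_le; intros Hlt.
    pose proof (Hy t (h t) (h x - e) T3 ltac:(lra) ltac:(lra) ltac:(lra)). lra.
Qed.

Lemma IVT_value (f : R -> R) (a b c : R) :
  a < b -> (forall t, a <= t <= b -> continuity_pt f t) ->
  f a < c -> c < f b -> exists t, a <= t <= b /\ f t = c.
Proof.
  intros Hab Hf Ha Hb.
  destruct (IVT_interv (fun t => f t - c) a b) as [t [Ht E]]; try lra.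
  - intros t Ht. apply continuity_pt_minus; [now apply Hf |].
    apply continuity_pt_const. now intros u v.
  - exists t; split; [trivial | lra].
Qed.

(* For fixed x solve f x y = a for y = h x, by the intermediate value theorem;
   then g x (h x) crosses the level b, again by the intermediate value
   theorem. *)
Lemma opposed_monotone_open_map (f g : R -> R -> R) (x0 y0 r : R) :
  0 < r -> opposed_monotone f g x0 y0 r ->
  (forall x y, x0 - r <= x <= x0 + r -> y0 - r <= y <= y0 + r ->
     continuity_2d_pt f x y /\ continuity_2d_pt g x y) ->
  locally_2d (fun a b => exists x y,
    x0 - r <= x <= x0 + r /\ y0 - r <= y <= y0 + r /\ f x y = a /\ g x y = b)
    (f x0 y0) (g x0 y0).
Proof.
  intros Hr [Hx Hy] Hc.
  pose proof (Hy x0 (y0 - r) y0 ltac:(lra) ltac:(lra) ltac:(lra) ltac:(lra)).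
  pose proof (Hy x0 y0 (y0 + r) ltac:(lra) ltac:(lra) ltac:(lra) ltac:(lra)).
  destruct (continuity_2d_pt_lt f x0 (y0 - r) (f x0 y0)) as [d1 Hd1];
    [apply Hc; lra | lra |].
  destruct (continuity_2d_pt_gt f x0 (y0 + r) (f x0 y0)) as [d2 Hd2];
    [apply Hc; lra | lra |].
  set (d := Rmin r (Rmin (d1 / 2) (d2 / 2))).
  pose proof (cond_pos d1); pose proof (cond_pos d2).
  assert (Hd : 0 < d) by (repeat apply Rmin_pos; lra).
  assert (Dr : d <= r) by apply Rmin_l.
  assert (D1 : d <= d1 / 2) by min_le.
  assert (D2 : d <= d2 / 2) by min_le.
  specialize (Hd1 (x0 + d) (y0 - r) ltac:(apply Rabs_def1; lra)
    ltac:(apply Rabs_def1; lra)).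
  specialize (Hd2 (x0 - d) (y0 + r) ltac:(apply Rabs_def1; lra)
    ltac:(apply Rabs_def1; lra)).
  set (e := d / 2). assert (He : 0 < e < d) by (unfold e; lra).
  pose proof (Hx (x0 - e) x0 y0 ltac:(lra) ltac:(lra) ltac:(lra) ltac:(lra)).
  pose proof (Hx x0 (x0 + e) y0 ltac:(lra) ltac:(lra) ltac:(lra) ltac:(lra)).
  set (a0 := f x0 y0) in *; set (b0 := g x0 y0) in *.
  set (m := Rmin (Rmin (a0 - f (x0 + d) (y0 - r)) (f (x0 - d) (y0 + r) - a0))
    (Rmin (Rmin (a0 - f (x0 - e) y0) (f (x0 + e) y0 - a0))
          (Rmin (b0 - g (x0 - e) y0) (g (x0 + e) y0 - b0)))).
  assert (Hm : 0 < m) by (repeat apply Rmin_pos; lra).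
  exists (mkposreal m Hm); intros a b Ha Hb; simpl in Ha, Hb.
  apply Rabs_def2 in Ha; apply Rabs_def2 in Hb.
  assert (Hms : m <= a0 - f (x0 + d) (y0 - r) /\ m <= f (x0 - d) (y0 + r) - a0 /\
    m <= a0 - f (x0 - e) y0 /\ m <= f (x0 + e) y0 - a0 /\
    m <= b0 - g (x0 - e) y0 /\ m <= g (x0 + e) y0 - b0).
  { unfold m; repeat split; min_le. }
  assert (Hex : forall x, exists y, x0 - d < x < x0 + d ->
    y0 - r < y < y0 + r /\ f x y = a).
  { intros x. destruct (classic (x0 - d < x < x0 + d)) as [Hxd | Hxd];
      [| exists 0; tauto].
    pose proof (Hx x (x0 + d) (y0 - r) ltac:(lra) ltac:(lra) ltac:(lra) ltac:(lra)).
    pose proof (Hx (x0 - d) x (y0 + r) ltac:(lra) ltac:(lra) ltac:(lra) ltac:(lra)).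
    destruct (IVT_value (f x) (y0 - r) (y0 + r) a) as [y [Hyr Ey]]; try lra.
    - intros t Ht. apply (continuity_2d_pt_comp_1d f (fun _ => x) (fun t => t)).
      + apply Hc; lra.
      + apply continuity_pt_const. now intros u v.
      + apply derivable_continuous_pt, derivable_pt_id.
    - exists y; intros _; split; [| exact Ey].
      destruct (Req_dec y (y0 - r)); [subst y; lra |].
      destruct (Req_dec y (y0 + r)); [subst y; lra |]. lra. }
  destruct (choice _ Hex) as [h Hh].
  assert (Hhc : forall x, x0 - d < x < x0 + d -> continuity_pt h x).
  { intros x. apply (implicit_continuous f h a d x0 y0 r x); trivial.
    - intros; apply Hy; lra.
    - intros; apply Hc; lra. }
  destruct (Hh (x0 - e)) as [Hl El]; [lra |].
  destruct (Hh (x0 + e)) as [Hu Eu]; [lra |].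
  assert (Hl0 : y0 < h (x0 - e)).
  { apply Rnot_le_lt; intros [Hlt | E]; [| rewrite E in El; lra].
    pose proof (Hy (x0 - e) (h (x0 - e)) y0 ltac:(lra) ltac:(lra) Hlt ltac:(lra)). lra. }
  assert (Hu0 : h (x0 + e) < y0).
  { apply Rnot_le_lt; intros [Hlt | E]; [| rewrite <- E in Eu; lra].
    pose proof (Hy (x0 + e) y0 (h (x0 + e)) ltac:(lra) ltac:(lra) Hlt ltac:(lra)). lra. }
  pose proof (Hy (x0 - e) y0 (h (x0 - e)) ltac:(lra) ltac:(lra) Hl0 ltac:(lra)).
  pose proof (Hy (x0 + e) (h (x0 + e)) y0 ltac:(lra) ltac:(lra) Hu0 ltac:(lra)).
  destruct (IVT_value (fun x => g x (h x)) (x0 - e) (x0 + e) b)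
    as [x [Hxe Ex]]; try lra.
  - intros x Hxe. destruct (Hh x ltac:(lra)) as [Hyx _].
    apply (continuity_2d_pt_comp_1d g (fun x => x) h).
    + apply Hc; lra.
    + apply derivable_continuous_pt, derivable_pt_id.
    + apply Hhc; lra.
  - destruct (Hh x ltac:(lra)) as [Hyx Efx].
    exists x, (h x). repeat split; trivial; lra.
Qed.

Lemma opposed_partials_local_coordinates (U : R * R -> Prop)
  (f g fx fy gx gy : R -> R -> R) :
  open U -> has_partials_on U f fx fy -> has_partials_on U g gx gy ->
  (forall x y, U (x, y) ->
     0 < fx x y /\ 0 < fy x y /\ 0 < gx x y /\ gy x y < 0) ->
  (forall x y, U (x, y) -> continuity_2d_pt fx x y /\ continuity_2d_pt gx x y) ->
  local_coordinates U f g.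
Proof.
  intros HU Hf Hg Hs Hc [x0 y0] Hp.
  destruct (open_locally_2d U x0 y0 HU Hp) as [d Hd].
  pose proof (cond_pos d) as Hdpos.
  set (r := d / 2). assert (Hr : 0 < r < d) by (unfold r; lra).
  assert (HQ : forall x y, x0 - r <= x <= x0 + r -> y0 - r <= y <= y0 + r ->
    U (x, y)) by (intros; apply Hd; apply Rabs_def1; lra).
  assert (Hdf : forall x y, U (x, y) ->
    differentiable_pt_lim f x y (fx x y) (fy x y) /\
    differentiable_pt_lim g x y (gx x y) (gy x y)).
  { intros x y Hxy; split; eapply has_partials_differentiable; eauto;
      apply (Hc x y Hxy). }
  assert (Hcont : forall x y, U (x, y) ->
    continuity_2d_pt f x y /\ continuity_2d_pt g x y).
  { intros x y Hxy; destruct (Hdf x y Hxy).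
    split; apply differentiable_continuity_pt; do 2 eexists; eassumption. }
  assert (Hmon : opposed_monotone f g x0 y0 r).
  { split.
    - intros x x' y H1 H2 H3 H4.
      assert (Hin : forall t, x <= t <= x' -> U (t, y)) by (intros; apply HQ; lra).
      split.
      + apply (derive_pos_increasing (fun u => f u y) (fun u => fx u y)); trivial;
          intros t Ht; [apply Hf | apply Hs]; auto.
      + apply (derive_pos_increasing (fun u => g u y) (fun u => gx u y)); trivial;
          intros t Ht; [apply Hg | apply Hs]; auto.
    - intros x y y' H1 H2 H3 H4.
      assert (Hin : forall t, y <= t <= y' -> U (x, t)) by (intros; apply HQ; lra).
      split.
      + apply (derive_pos_increasing (f x) (fy x)); trivial;
          intros t Ht; [apply Hf | apply Hs]; auto.
      + apply (derive_neg_decreasing (g x) (gy x)); trivial;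
          intros t Ht; [apply Hg | apply Hs]; auto. }
  set (V := fun p : R * R =>
    x0 - r < fst p < x0 + r /\ y0 - r < snd p < y0 + r).
  set (sol := fun a b (p : R * R) =>
    V p /\ f (fst p) (snd p) = a /\ g (fst p) (snd p) = b).
  set (W := fun q : R * R => exists p, sol (fst q) (snd q) p).
  set (inv := fun a b => epsilon (inhabits (0, 0)) (sol a b)).
  set (X := fun a b => fst (inv a b)); set (Y := fun a b => snd (inv a b)).
  assert (HV : forall p, V p -> U p).
  { intros [x y] [H1 H2]; simpl in *. apply HQ; lra. }
  assert (HW : forall a b, W (a, b) ->
    V (X a b, Y a b) /\ f (X a b) (Y a b) = a /\ g (X a b) (Y a b) = b).
  { intros a b HWab.
    pose proof (epsilon_spec (inhabits (0, 0)) (sol a b) HWab) as H.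
    fold (inv a b) in H. unfold X, Y. now rewrite <- surjective_pairing. }
  assert (Hinj : forall x y x' y', V (x, y) -> V (x', y') ->
    f x y = f x' y' -> g x y = g x' y' -> x = x' /\ y = y').
  { intros x y x' y' [H1 H2] [H3 H4]; simpl in *.
    apply (opposed_monotone_injective f g x0 y0 r); trivial; lra. }
  assert (Hloc : forall a b, W (a, b) -> forall eps : posreal,
    locally_2d (fun u v => W (u, v) /\
      Rabs (X u v - X a b) < eps /\ Rabs (Y u v - Y a b) < eps) a b).
  { intros a b HWab eps.
    destruct (HW a b HWab) as [[HVx HVy] [Ea Eb]]; simpl in HVx, HVy.
    set (x := X a b) in *; set (y := Y a b) in *.
    pose proof (cond_pos eps).
    set (M := Rmin (eps / 2) (Rmin (Rmin (x - (x0 - r)) (x0 + r - x))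
      (Rmin (y - (y0 - r)) (y0 + r - y)))).
    assert (HM : 0 < M) by (repeat apply Rmin_pos; lra).
    assert (HMs : M <= eps / 2 /\ M <= x - (x0 - r) /\ M <= x0 + r - x /\
      M <= y - (y0 - r) /\ M <= y0 + r - y).
    { unfold M; repeat split; min_le. }
    set (s := M / 2). assert (Hs0 : 0 < s < M) by (unfold s; lra).
    destruct (opposed_monotone_open_map f g x y s) as [e He].
    - lra.
    - apply (opposed_monotone_subsquare f g x0 y0 r); trivial; lra.
    - intros; apply Hcont, HQ; lra.
    - rewrite Ea, Eb in He. exists e. intros u v Hu Hv.
      destruct (He u v Hu Hv) as (x' & y' & Hx' & Hy' & Eu & Ev).
      assert (HV' : V (x', y')) by (split; simpl; lra).
      assert (HWuv : W (u, v)) by (exists (x', y'); repeat split; trivial; apply HV').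
      destruct (HW u v HWuv) as [HVuv [Eu' Ev']].
      destruct (Hinj _ _ _ _ HVuv HV') as [-> ->]; try congruence.
      split; [trivial | split; apply Rabs_def1; lra]. }
  assert (HVW : forall x y, V (x, y) ->
    W (f x y, g x y) /\ X (f x y) (g x y) = x /\ Y (f x y) (g x y) = y).
  { intros x y Hxy.
    assert (HWxy : W (f x y, g x y)) by (exists (x, y); now repeat split; apply Hxy).
    destruct (HW _ _ HWxy) as [HVxy [E1 E2]].
    split; [trivial |]. now apply Hinj. }
  exists V, W, X, Y.
  split; [split; simpl; lra |].
  split; [| split; [| split; [exact HV | split; [exact HVW |]]]].
  - apply locally_2d_open. intros x y [H1 H2]; simpl in *.
    set (m := Rmin (Rmin (x - (x0 - r)) (x0 + r - x))
      (Rmin (y - (y0 - r)) (y0 + r - y))).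
    assert (Hm : 0 < m) by (repeat apply Rmin_pos; lra).
    assert (Hms : m <= x - (x0 - r) /\ m <= x0 + r - x /\
      m <= y - (y0 - r) /\ m <= y0 + r - y) by (unfold m; repeat split; min_le).
    exists (mkposreal m Hm); intros u v Hu Hv; simpl in Hu, Hv.
    apply Rabs_def2 in Hu; apply Rabs_def2 in Hv. split; simpl; lra.
  - apply locally_2d_open. intros a b Hab.
    destruct (Hloc a b Hab (mkposreal 1 Rlt_0_1)) as [e He].
    exists e; intros u v Hu Hv; now apply He.
  - intros a b Hab. destruct (HW a b Hab) as [HVab [Ea Eb]].
    do 3 (split; [trivial |]).
    destruct (Hdf _ _ (HV _ HVab)) as [Df Dg].
    destruct (Hs _ _ (HV _ HVab)) as (S1 & S2 & S3 & S4).
    destruct (inverse_differentiable f g X Y a b _ _ _ _ Df Dg) as [DX DY].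
    + nra.
    + intros eps. destruct (Hloc a b Hab eps) as [e He].
      exists e; intros u v Hu Hv; now apply He.
    + intros eps. destruct (Hloc a b Hab eps) as [e He].
      exists e; intros u v Hu Hv; now apply He.
    + destruct (Hloc a b Hab (mkposreal 1 Rlt_0_1)) as [e He].
      exists e; intros u v Hu Hv. apply HW. now apply He.
    + split; do 2 eexists; eassumption.
Qed.

Lemma smooth_on_dx (U : R * R -> Prop) (f : R -> R -> R) :
  smooth_on U f -> smooth_on U (dx f).
Proof. intros Hf n x y Hxy. apply (Hf (S n) x y Hxy). Qed.

Lemma smooth_on_dy (U : R * R -> Prop) (f : R -> R -> R) :
  smooth_on U f -> smooth_on U (dy f).
Proof. intros Hf n x y Hxy. apply (Hf (S n) x y Hxy). Qed.

Lemma smooth_on_continuity (U : R * R -> Prop) (f : R -> R -> R) (x y : R) :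
  smooth_on U f -> U (x, y) -> continuity_2d_pt f x y.
Proof. intros Hf Hxy. apply (Hf 0%nat x y Hxy). Qed.

Lemma smooth_on_has_partials (U : R * R -> Prop) (f : R -> R -> R) :
  smooth_on U f -> has_partials_on U f (dx f) (dy f).
Proof.
  intros Hf x y Hxy. destruct (Hf 1%nat x y Hxy) as (_ & H1 & H2 & _).
  split; now apply Derive_correct.
Qed.

Lemma smooth_on_differentiable (U : R * R -> Prop) (f : R -> R -> R) (x y : R) :
  open U -> smooth_on U f -> U (x, y) ->
  differentiable_pt_lim f x y (dx f x y) (dy f x y).
Proof.
  intros HU Hf Hxy. apply (has_partials_differentiable U); trivial.
  - now apply smooth_on_has_partials.
  - now apply (smooth_on_continuity U); [apply smooth_on_dx |].
Qed.

Lemma smooth_on_mixed (U : R * R -> Prop) (f : R -> R -> R) (x y : R) :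
  open U -> smooth_on U f -> U (x, y) -> dx (dy f) x y = dy (dx f) x y.
Proof.
  intros HU Hf Hxy. apply (Schwarz f x y).
  - destruct (open_locally_2d U x y HU Hxy) as [d Hd].
    exists d; intros u v Hu Hv. specialize (Hd u v Hu Hv).
    destruct (Hf 2%nat u v Hd) as (_ & H1 & H2 & H3 & H4).
    repeat split; [exact H1 | exact H2 | apply H4 | apply H3].
  - apply (smooth_on_continuity U (dx (dy f))); trivial.
    now apply smooth_on_dx, smooth_on_dy.
  - apply (smooth_on_continuity U (dy (dx f))); trivial.
    now apply smooth_on_dy, smooth_on_dx.
Qed.

Lemma constant_astigmatism_expanded (U : R * R -> Prop) (z : R -> R -> R)
  (x y : R) :
  open U -> smooth_on U z -> (forall x y, U (x, y) -> 0 < z x y) ->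
  constant_astigmatism_on U z -> U (x, y) ->
  dy (dy z) x y - dx (dx z) x y / z x y ^ 2 + 2 * dx z x y ^ 2 / z x y ^ 3 + 2 = 0.
Proof.
  intros HU Hz Hpos Heq Hxy.
  specialize (Heq x y Hxy).
  change (partial_derive 0 2 z x y) with (dy (dy z) x y) in Heq.
  assert (E : partial_derive 2 0 (fun u v => / z u v) x y =
    - (dx (dx z) x y / z x y ^ 2) + 2 * dx z x y ^ 2 / z x y ^ 3).
  { change (Derive (fun t => Derive (fun w => / z w y) t) x =
      - (dx (dx z) x y / z x y ^ 2) + 2 * dx z x y ^ 2 / z x y ^ 3).
    rewrite (Derive_ext_loc _ (fun t => - dx z t y / z t y ^ 2)).
    - apply is_derive_unique.
      destruct (smooth_on_has_partials U z Hz x y Hxy) as [H1 _].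
      destruct (smooth_on_has_partials U (dx z) (smooth_on_dx U z Hz) x y Hxy)
        as [H2 _].
      pose proof (Hpos x y Hxy).
      evar_last.
      { apply is_derive_div.
        - apply (is_derive_opp (fun t => dx z t y)). exact H2.
        - apply (is_derive_pow (fun t => z t y) 2). exact H1.
        - apply pow_nonzero. lra. }
      simpl. unfold opp; simpl. field. lra.
    - apply (locally_2d_1d_const_y (fun u v => Derive (fun w => / z w v) u =
        - dx z u v / z u v ^ 2)).
      destruct (open_locally_2d U x y HU Hxy) as [d Hd].
      exists d; intros u v Hu Hv. specialize (Hd u v Hu Hv).
      apply is_derive_unique. apply (is_derive_inv (fun w => z w v)).
      + apply (smooth_on_has_partials U z Hz u v Hd).
      + pose proof (Hpos u v Hd). lra. }
  rewrite E in Heq. lra.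
Qed.

(* The argument in (0, PI) of z_x + s z z_y + 2 i z^(3/2), for s = 1 or -1. *)
Definition characteristic_angle (s : R) (z : R -> R -> R) (x y : R) : R :=
  PI / 2 - atan ((dx z x y + s * (z x y * dy z x y))
                 / (2 * (z x y * sqrt (z x y)))).

(* The constant astigmatism equation enters here only: along its
   characteristics dy = - s z dx the angle changes by - sqrt z dx. *)
Lemma characteristic_angle_derive (s : R) (zeta P Q : R -> R)
  (t pxx pxy pyy kappa : R) :
  s ^ 2 = 1 -> 0 < zeta t ->
  pyy - pxx / zeta t ^ 2 + 2 * P t ^ 2 / zeta t ^ 3 + 2 = 0 ->
  is_derive zeta t (P t * kappa + Q t * (- s * zeta t * kappa)) ->
  is_derive P t (pxx * kappa + pxy * (- s * zeta t * kappa)) ->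
  is_derive Q t (pxy * kappa + pyy * (- s * zeta t * kappa)) ->
  is_derive (fun v => PI / 2 - atan ((P v + s * (zeta v * Q v))
                 / (2 * (zeta v * sqrt (zeta v))))) t (- (sqrt (zeta t) * kappa)).
Proof.
  intros Hs Hz Heq Dz DP DQ.
  assert (Hr : 0 < sqrt (zeta t)) by now apply sqrt_lt_R0.
  assert (Er : zeta t = sqrt (zeta t) ^ 2) by (rewrite pow2_sqrt; lra).
  assert (Ep : pxx = zeta t ^ 2 * pyy + 2 * P t ^ 2 / zeta t + 2 * zeta t ^ 2).
  { transitivity (pxx + zeta t ^ 2 *
      (pyy - pxx / zeta t ^ 2 + 2 * P t ^ 2 / zeta t ^ 3 + 2)).
    - rewrite Heq; ring.
    - field; lra. }
  evar_last.
  { auto_derive; [| reflexivity].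
    repeat split; try (eexists; eassumption); trivial.
    apply Rgt_not_eq, Rmult_lt_0_compat; [lra | now apply Rmult_lt_0_compat]. }
  rewrite (is_derive_unique (fun v : R => zeta v) _ _ Dz),
    (is_derive_unique (fun v : R => P v) _ _ DP),
    (is_derive_unique (fun v : R => Q v) _ _ DQ), Ep.
  set (r := sqrt (zeta t)) in *. rewrite Er.
  assert (Hs' : s = 1 \/ s = -1) by
    (destruct (Rmult_integral (s - 1) (s + 1)); [lra | left | right]; lra).
  assert (Hc : 0 < 2 * (r ^ 2 * r))
    by (apply Rmult_lt_0_compat; [lra | rewrite <- Er; now apply Rmult_lt_0_compat]).
  destruct Hs' as [-> | ->]; field; (split; [lra |]);
    apply Rgt_not_eq, Rplus_lt_le_0_compat;
    now first [apply Rmult_lt_0_compat | apply Rle_0_sqr].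
Qed.

Lemma characteristic_radius_pos (s : R) (z : R -> R -> R) (x y : R) :
  0 < z x y -> 0 < (dx z x y + s * (z x y * dy z x y)) ^ 2 + 4 * z x y ^ 3.
Proof.
  intros Hz. pose proof (pow2_ge_0 (dx z x y + s * (z x y * dy z x y))).
  pose proof (pow_lt _ 3 Hz). lra.
Qed.

Lemma characteristic_angle_sin_cos (s : R) (z : R -> R -> R) (x y : R) :
  0 < z x y ->
  let rho := sqrt ((dx z x y + s * (z x y * dy z x y)) ^ 2 + 4 * z x y ^ 3) in
  sin (characteristic_angle s z x y) = 2 * (z x y * sqrt (z x y)) / rho /\
  cos (characteristic_angle s z x y) =
    (dx z x y + s * (z x y * dy z x y)) / rho.
Proof.
  intros Hz rho.
  set (u := dx z x y + s * (z x y * dy z x y)).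
  assert (Hr : 0 < sqrt (z x y)) by now apply sqrt_lt_R0.
  set (c := 2 * (z x y * sqrt (z x y))).
  assert (Hc : 0 < c)
    by (apply Rmult_lt_0_compat; [lra | now apply Rmult_lt_0_compat]).
  assert (Ec : c ^ 2 = 4 * z x y ^ 3).
  { unfold c. replace ((2 * (z x y * sqrt (z x y))) ^ 2) with
      (4 * z x y ^ 2 * sqrt (z x y) ^ 2) by ring.
    rewrite pow2_sqrt by lra. ring. }
  assert (Hrho : 0 < rho) by now apply sqrt_lt_R0, characteristic_radius_pos.
  assert (E : sqrt (1 + Rsqr (u / c)) = rho / c).
  { rewrite <- (sqrt_pow2 (rho / c)) by (apply Rlt_le, Rdiv_lt_0_compat; lra).
    f_equal. unfold Rsqr.
    replace ((rho / c) ^ 2) with (rho ^ 2 / c ^ 2) by (field; lra).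
    unfold rho. rewrite pow2_sqrt by now apply Rlt_le, characteristic_radius_pos.
    fold u. rewrite <- Ec. field. lra. }
  unfold characteristic_angle. fold u c.
  rewrite sin_shift, cos_shift, cos_atan, sin_atan, E.
  split; field; lra.
Qed.

Lemma continuity_2d_pt_sqrt (f : R -> R -> R) (x y : R) :
  0 <= f x y -> continuity_2d_pt f x y ->
  continuity_2d_pt (fun u v => sqrt (f u v)) x y.
Proof.
  intros Hf Hc. apply (continuity_1d_2d_pt_comp sqrt f); trivial.
  now apply continuity_pt_sqrt.
Qed.

Lemma continuity_2d_pt_pow (f : R -> R -> R) (n : nat) (x y : R) :
  continuity_2d_pt f x y -> continuity_2d_pt (fun u v => f u v ^ n) x y.
Proof.
  intros Hf. induction n as [| n IH]; simpl.
  - apply continuity_2d_pt_const.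
  - now apply continuity_2d_pt_mult.
Qed.

Lemma continuity_2d_pt_div (f g : R -> R -> R) (x y : R) :
  continuity_2d_pt f x y -> continuity_2d_pt g x y -> g x y <> 0 ->
  continuity_2d_pt (fun u v => f u v / g u v) x y.
Proof.
  intros Hf Hg H0. apply continuity_2d_pt_mult; trivial.
  now apply continuity_2d_pt_inv.
Qed.

Lemma characteristic_speed_continuity (s : R) (U : R * R -> Prop)
  (z : R -> R -> R) (x y : R) :
  smooth_on U z -> U (x, y) ->
  continuity_2d_pt (fun u v => dx z u v + s * (z u v * dy z u v)) x y.
Proof.
  intros Hz Hxy.
  apply continuity_2d_pt_plus;
    [| apply continuity_2d_pt_mult;
       [apply continuity_2d_pt_const | apply continuity_2d_pt_mult]];
    apply (smooth_on_continuity U); trivial;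
    now (apply smooth_on_dx || apply smooth_on_dy).
Qed.

Lemma characteristic_radius_continuity (s : R) (U : R * R -> Prop)
  (z : R -> R -> R) (x y : R) :
  smooth_on U z -> U (x, y) -> 0 < z x y ->
  continuity_2d_pt (fun u v =>
    sqrt ((dx z u v + s * (z u v * dy z u v)) ^ 2 + 4 * z u v ^ 3)) x y.
Proof.
  intros Hz Hxy Hpos.
  apply (continuity_2d_pt_sqrt (fun u v =>
    (dx z u v + s * (z u v * dy z u v)) ^ 2 + 4 * z u v ^ 3)).
  - now apply Rlt_le, characteristic_radius_pos.
  - apply continuity_2d_pt_plus.
    + apply (continuity_2d_pt_pow (fun u v => dx z u v + s * (z u v * dy z u v))).
      now apply (characteristic_speed_continuity s U).
    + apply continuity_2d_pt_mult; [apply continuity_2d_pt_const |].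
      apply continuity_2d_pt_pow. now apply (smooth_on_continuity U).
Qed.

Lemma characteristic_angle_continuity (s : R) (U : R * R -> Prop)
  (z : R -> R -> R) (x y : R) :
  smooth_on U z -> U (x, y) -> 0 < z x y ->
  continuity_2d_pt (characteristic_angle s z) x y.
Proof.
  intros Hz Hxy Hpos.
  assert (Hr : 0 < sqrt (z x y)) by now apply sqrt_lt_R0.
  assert (Cz : continuity_2d_pt z x y) by now apply (smooth_on_continuity U).
  apply continuity_2d_pt_minus; [apply continuity_2d_pt_const |].
  apply (continuity_1d_2d_pt_comp atan).
  - apply derivable_continuous_pt, derivable_pt_atan.
  - apply continuity_2d_pt_div.
    + now apply (characteristic_speed_continuity s U).
    + apply continuity_2d_pt_mult; [apply continuity_2d_pt_const |].
      apply continuity_2d_pt_mult; trivial.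
      apply continuity_2d_pt_sqrt; [lra | trivial].
    + apply Rgt_not_eq, Rmult_lt_0_compat; [lra | now apply Rmult_lt_0_compat].
Qed.

Lemma Rplus_z_characteristic (z : R -> R -> R) (x y : R) :
  Rplus_z z x y = sqrt ((dx z x y + 1 * (z x y * dy z x y)) ^ 2 + 4 * z x y ^ 3).
Proof. unfold Rplus_z. now rewrite Rmult_1_l. Qed.

Lemma Rminus_z_characteristic (z : R -> R -> R) (x y : R) :
  Rminus_z z x y =
    sqrt ((dx z x y + -1 * (z x y * dy z x y)) ^ 2 + 4 * z x y ^ 3).
Proof. unfold Rminus_z. do 3 f_equal. ring. Qed.

Lemma Rplus_z_pos (z : R -> R -> R) (x y : R) : 0 < z x y -> 0 < Rplus_z z x y.
Proof.
  intros Hz. rewrite Rplus_z_characteristic.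
  now apply sqrt_lt_R0, characteristic_radius_pos.
Qed.

Lemma Rminus_z_pos (z : R -> R -> R) (x y : R) : 0 < z x y -> 0 < Rminus_z z x y.
Proof.
  intros Hz. rewrite Rminus_z_characteristic.
  now apply sqrt_lt_R0, characteristic_radius_pos.
Qed.

Lemma Rplus_z_continuity (U : R * R -> Prop) (z : R -> R -> R) (x y : R) :
  smooth_on U z -> U (x, y) -> 0 < z x y -> continuity_2d_pt (Rplus_z z) x y.
Proof.
  intros Hz Hxy Hpos.
  eapply continuity_2d_pt_ext.
  - intros u v. symmetry. apply Rplus_z_characteristic.
  - now apply (characteristic_radius_continuity 1 U).
Qed.

Lemma Rminus_z_continuity (U : R * R -> Prop) (z : R -> R -> R) (x y : R) :
  smooth_on U z -> U (x, y) -> 0 < z x y -> continuity_2d_pt (Rminus_z z) x y.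
Proof.
  intros Hz Hxy Hpos.
  eapply continuity_2d_pt_ext.
  - intros u v. symmetry. apply Rminus_z_characteristic.
  - now apply (characteristic_radius_continuity (-1) U).
Qed.

Lemma Rpower_half_integer (r : R) (n : nat) (q : R) :
  0 < r -> q = INR n + / 2 -> Rpower r q = r ^ n * sqrt r.
Proof.
  intros Hr ->. now rewrite Rpower_plus, Rpower_pow, Rpower_sqrt.
Qed.

Lemma cos_sin_eq_shift (s t : R) :
  cos s = cos t -> sin s = sin t -> exists k : Z, s = t + IZR k * (2 * PI).
Proof.
  intros Hc Hs.
  assert (Hd : cos (2 * ((s - t) / 2)) = 1).
  { replace (2 * ((s - t) / 2)) with (s - t) by field.
    rewrite cos_minus, Hc, Hs. rewrite <- (sin2_cos2 t). unfold Rsqr. ring. }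
  rewrite cos_2a_sin in Hd.
  destruct (sin_eq_0_0 ((s - t) / 2)) as [k Hk].
  - apply Rsqr_0_uniq. unfold Rsqr. lra.
  - exists k. lra.
Qed.

Lemma integer_valued_constant (h : R -> R) (a b : R) :
  a <= b -> (forall t, a <= t <= b -> continuity_pt h t) ->
  (forall t, a <= t <= b -> exists k : Z, h t = IZR k) -> h a = h b.
Proof.
  intros Hab Hc Hk.
  assert (Hgap : forall k l : Z, IZR k + / 2 = IZR l -> False).
  { intros k l E.
    assert (F : IZR (2 * k + 1) = IZR (2 * l))
      by (rewrite plus_IZR, !mult_IZR; lra).
    apply eq_IZR in F. lia. }
  assert (Hstep : forall k l : Z, IZR k < IZR l -> IZR k + / 2 < IZR l).
  { intros k l H. apply lt_IZR in H.
    assert (G : (k + 1 <= l)%Z) by lia. apply IZR_le in G.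
    rewrite plus_IZR in G. lra. }
  destruct Hab as [Hab | ->]; [| trivial].
  destruct (Hk a ltac:(lra)) as [k Ek]; destruct (Hk b ltac:(lra)) as [l El].
  destruct (Rtotal_order (h a) (h b)) as [L | [E | L]]; [| trivial |]; exfalso.
  - destruct (IVT_value h a b (IZR k + / 2)) as [t [Ht Et]]; trivial; [lra | |].
    + rewrite El. apply Hstep. lra.
    + destruct (Hk t Ht) as [m Em]. apply (Hgap k m). lra.
  - destruct (IVT_value (fun t => - h t) a b (- (IZR l + / 2))) as [t [Ht Et]];
      trivial.
    + intros t Ht. now apply continuity_pt_opp, Hc.
    + rewrite Ek. apply Ropp_lt_contravar, Hstep. lra.
    + lra.
    + destruct (Hk t Ht) as [m Em]. apply (Hgap l m). lra.
Qed.

Lemma equal_up_to_shift_2PI (U : R * R -> Prop) (f g : R -> R -> R) :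
  path_connected U ->
  (forall x y, U (x, y) -> continuity_2d_pt f x y /\ continuity_2d_pt g x y) ->
  (forall x y, U (x, y) ->
     cos (f x y) = cos (g x y) /\ sin (f x y) = sin (g x y)) ->
  exists k : Z, forall x y, U (x, y) -> g x y = shift_2PI k f x y.
Proof.
  intros HU Hc Hfg.
  pose proof PI_RGT_0 as HPI.
  assert (Hk : forall x y, U (x, y) -> exists k : Z,
    (g x y - f x y) / (2 * PI) = IZR k).
  { intros x y Hxy. destruct (Hfg x y Hxy) as [H1 H2].
    destruct (cos_sin_eq_shift (g x y) (f x y)) as [k E]; try easy.
    exists k. rewrite E. field. lra. }
  destruct (classic (exists p, U p)) as [[[x0 y0] H0] | Hempty].
  2: { exists 0%Z. intros x y Hxy. exfalso. apply Hempty. now exists (x, y). }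
  destruct (Hk x0 y0 H0) as [k Ek].
  exists k. intros x y Hxy.
  destruct (HU _ _ H0 Hxy) as [c [[Cc Uc] [E0 E1]]].
  assert (E : (g x y - f x y) / (2 * PI) = IZR k).
  { rewrite <- Ek.
    set (h := fun t => (g (fst (c t)) (snd (c t)) - f (fst (c t)) (snd (c t)))
                       / (2 * PI)).
    assert (Eh : h 0 = h 1).
    { apply integer_valued_constant; [lra | |].
      - intros t Ht.
        assert (HUt : U (fst (c t), snd (c t)))
          by (rewrite <- surjective_pairing; now apply Uc).
        assert (C1 : continuity_pt (fun s => fst (c s)) t).
        { apply continuity_pt_filterlim.
          apply (continuous_comp c fst); [apply Cc |].
          destruct (c t). apply continuous_fst. }
        assert (C2 : continuity_pt (fun s => snd (c s)) t).
        { apply continuity_pt_filterlim.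
          apply (continuous_comp c snd); [apply Cc |].
          destruct (c t). apply continuous_snd. }
        apply continuity_pt_mult.
        + apply continuity_pt_minus.
          * apply (continuity_2d_pt_comp_1d g); trivial. now apply Hc.
          * apply (continuity_2d_pt_comp_1d f); trivial. now apply Hc.
        + apply continuity_pt_const. now intros u v.
      - intros t Ht. apply Hk. rewrite <- surjective_pairing. now apply Uc. }
    unfold h in Eh. rewrite E0, E1 in Eh. simpl in Eh. now symmetry. }
  unfold shift_2PI. rewrite <- E. field. lra.
Qed.

Lemma characteristic_angle_along (s : R) (U : R * R -> Prop) (z : R -> R -> R)
  (g h : R -> R) (t kappa : R) :
  open U -> smooth_on U z -> (forall x y, U (x, y) -> 0 < z x y) ->
  constant_astigmatism_on U z -> s ^ 2 = 1 -> U (g t, h t) ->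
  is_derive g t kappa -> is_derive h t (- s * z (g t) (h t) * kappa) ->
  is_derive (fun v => characteristic_angle s z (g v) (h v)) t
    (- (sqrt (z (g t) (h t)) * kappa)).
Proof.
  intros HU Hz Hpos Heq Hs Ht Dg Dh.
  assert (chain : forall f, smooth_on U f ->
    is_derive (fun v => f (g v) (h v)) t (dx f (g t) (h t) * kappa +
      dy f (g t) (h t) * (- s * z (g t) (h t) * kappa))).
  { intros f Hf. apply is_derive_Reals, derivable_pt_lim_comp_2d.
    - now apply (smooth_on_differentiable U).
    - now apply is_derive_Reals.
    - now apply is_derive_Reals. }
  apply (characteristic_angle_derive s (fun v => z (g v) (h v))
    (fun v => dx z (g v) (h v)) (fun v => dy z (g v) (h v)) t
    (dx (dx z) (g t) (h t)) (dy (dx z) (g t) (h t)) (dy (dy z) (g t) (h t)));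
    trivial.
  - now apply Hpos.
  - now apply (constant_astigmatism_expanded U).
  - now apply chain.
  - now apply chain, smooth_on_dx.
  - rewrite <- (smooth_on_mixed U) by trivial. now apply chain, smooth_on_dy.
Qed.

Lemma local_chart_differentiable (U V W : R * R -> Prop)
  (f g X Y : R -> R -> R) (a b fx fy gx gy : R) :
  local_chart U f g V W X Y -> W (a, b) ->
  differentiable_pt_lim f (X a b) (Y a b) fx fy ->
  differentiable_pt_lim g (X a b) (Y a b) gx gy ->
  fx * gy - fy * gx <> 0 ->
  differentiable_pt_lim X a b
    (gy / (fx * gy - fy * gx)) (- fy / (fx * gy - fy * gx)) /\
  differentiable_pt_lim Y a b
    (- gx / (fx * gy - fy * gx)) (fx / (fx * gy - fy * gx)).
Proof.
  intros (_ & OW & _ & _ & HW) Hab Df Dg HD.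
  destruct (HW a b Hab) as (_ & _ & _ & DX & DY).
  apply (inverse_differentiable f g); trivial.
  - now apply differentiable_continuity_pt.
  - now apply differentiable_continuity_pt.
  - destruct (open_locally_2d W a b OW Hab) as [d Hd].
    exists d; intros u v Hu Hv.
    destruct (HW u v (Hd u v Hu Hv)) as (_ & E1 & E2 & _). now split.
Qed.

Lemma is_alpha_differentiable (U : R * R -> Prop) (z alpha : R -> R -> R)
  (x y : R) :
  open U -> smooth_on U z -> U (x, y) -> 0 < z x y -> is_alpha U z alpha ->
  differentiable_pt_lim alpha x y
    (Rplus_z z x y / (4 * z x y)) (Rplus_z z x y / (4 * z x y ^ 2)).
Proof.
  intros HU Hz Hxy Hpos Ha.
  apply (has_partials_differentiable U alpha _ _ x y HU Hxy Ha).
  apply continuity_2d_pt_div; [now apply (Rplus_z_continuity U) | | lra].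
  apply continuity_2d_pt_mult; [apply continuity_2d_pt_const |].
  now apply (smooth_on_continuity U).
Qed.

Lemma is_beta_differentiable (U : R * R -> Prop) (z beta : R -> R -> R)
  (x y : R) :
  open U -> smooth_on U z -> U (x, y) -> 0 < z x y -> is_beta U z beta ->
  differentiable_pt_lim beta x y
    (Rminus_z z x y / (4 * z x y)) (- (Rminus_z z x y / (4 * z x y ^ 2))).
Proof.
  intros HU Hz Hxy Hpos Hb.
  apply (has_partials_differentiable U beta _ _ x y HU Hxy Hb).
  apply continuity_2d_pt_div; [now apply (Rminus_z_continuity U) | | lra].
  apply continuity_2d_pt_mult; [apply continuity_2d_pt_const |].
  now apply (smooth_on_continuity U).
Qed.

Lemma characteristic_chart_derive (U V W : R * R -> Prop)
  (z alpha beta X Y : R -> R -> R) (a b : R) :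
  open U -> smooth_on U z -> (forall x y, U (x, y) -> 0 < z x y) ->
  is_alpha U z alpha -> is_beta U z beta ->
  local_chart U alpha beta V W X Y -> W (a, b) ->
  let x := X a b in let y := Y a b in
  (is_derive (fun t => X t b) a (2 * z x y / Rplus_z z x y) /\
   is_derive (fun t => Y t b) a
     (- -1 * z x y * (2 * z x y / Rplus_z z x y))) /\
  (is_derive (fun t => X a t) b (2 * z x y / Rminus_z z x y) /\
   is_derive (fun t => Y a t) b
     (- (1) * z x y * (2 * z x y / Rminus_z z x y))).
Proof.
  intros HU Hz Hpos Ha Hb Hch HW x y.
  assert (Hxy : U (x, y)).
  { destruct Hch as (_ & _ & HVU & _ & Hch). apply HVU, (Hch a b HW). }
  pose proof (Hpos x y Hxy) as Hzp.
  pose proof (Rplus_z_pos z x y Hzp) as Hp.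
  pose proof (Rminus_z_pos z x y Hzp) as Hm.
  assert (HD : Rplus_z z x y / (4 * z x y) * - (Rminus_z z x y / (4 * z x y ^ 2))
    - Rplus_z z x y / (4 * z x y ^ 2) * (Rminus_z z x y / (4 * z x y)) =
    - (Rplus_z z x y * Rminus_z z x y / (8 * z x y ^ 3))) by (field; lra).
  destruct (local_chart_differentiable U V W alpha beta X Y a b _ _ _ _ Hch HW
    (is_alpha_differentiable U z alpha x y HU Hz Hxy Hzp Ha)
    (is_beta_differentiable U z beta x y HU Hz Hxy Hzp Hb)) as [DX DY].
  { rewrite HD. apply Ropp_neq_0_compat, Rgt_not_eq, Rdiv_lt_0_compat.
    - now apply Rmult_lt_0_compat.
    - pose proof (pow_lt _ 3 Hzp). lra. }
  rewrite HD in DX, DY.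
  apply differentiable_pt_lim_is_derive in DX, DY.
  destruct DX as [DX1 DX2]; destruct DY as [DY1 DY2].
  split; split; (evar_last; [eassumption | field; lra]).
Qed.

Lemma is_phi1_characteristic (U : R * R -> Prop) (z phi : R -> R -> R) (x y : R) :
  is_phi1 U z phi -> U (x, y) -> 0 < z x y ->
  cos (phi x y) =
    cos (characteristic_angle (-1) z x y - characteristic_angle 1 z x y) /\
  sin (phi x y) =
    sin (characteristic_angle (-1) z x y - characteristic_angle 1 z x y).
Proof.
  intros [_ Hphi] Hxy Hz. destruct (Hphi x y Hxy) as [-> ->].
  destruct (characteristic_angle_sin_cos 1 z x y Hz) as [S1 C1].
  destruct (characteristic_angle_sin_cos (-1) z x y Hz) as [S2 C2].
  rewrite <- Rplus_z_characteristic in S1, C1.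
  rewrite <- Rminus_z_characteristic in S2, C2.
  pose proof (Rplus_z_pos z x y Hz); pose proof (Rminus_z_pos z x y Hz).
  assert (Er : sqrt (z x y) ^ 2 = z x y) by (apply pow2_sqrt; lra).
  rewrite cos_minus, sin_minus, S1, C1, S2, C2.
  rewrite (Rpower_half_integer (z x y) 2 (5 / 2) Hz) by (simpl; lra).
  set (r := sqrt (z x y)) in *. rewrite <- Er.
  split; field; lra.
Qed.

Lemma is_phi2_characteristic (U : R * R -> Prop) (z phi : R -> R -> R) (x y : R) :
  is_phi2 U z phi -> U (x, y) -> 0 < z x y ->
  cos (phi x y) = cos (characteristic_angle 1 z x y +
                       characteristic_angle (-1) z x y + 2 * PI) /\
  sin (phi x y) = sin (characteristic_angle 1 z x y +
                       characteristic_angle (-1) z x y + 2 * PI).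
Proof.
  intros [_ Hphi] Hxy Hz. destruct (Hphi x y Hxy) as [-> ->].
  destruct (characteristic_angle_sin_cos 1 z x y Hz) as [S1 C1].
  destruct (characteristic_angle_sin_cos (-1) z x y Hz) as [S2 C2].
  rewrite <- Rplus_z_characteristic in S1, C1.
  rewrite <- Rminus_z_characteristic in S2, C2.
  pose proof (Rplus_z_pos z x y Hz); pose proof (Rminus_z_pos z x y Hz).
  assert (Er : sqrt (z x y) ^ 2 = z x y) by (apply pow2_sqrt; lra).
  set (theta := _ + characteristic_angle (-1) z x y).
  rewrite (cos_plus theta), (sin_plus theta), cos_2PI, sin_2PI. unfold theta.
  rewrite cos_plus, sin_plus, S1, C1, S2, C2.
  rewrite (Rpower_half_integer (z x y) 1 (3 / 2) Hz) by (simpl; lra).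
  set (r := sqrt (z x y)) in *. rewrite <- Er.
  split; field; lra.
Qed.

Lemma Backlund_swap (lambda : R) (W : R * R -> Prop) (phi psi : R -> R -> R) :
  lambda <> 0 -> Backlund lambda W phi psi -> Backlund (- lambda) W psi phi.
Proof.
  intros Hl H a b Hab. destruct (H a b Hab) as [H1 H2]. split.
  - apply (is_derive_ext (fun t => - ((psi a t - phi a t) / 2)));
      [intros t; simpl; field |].
    evar_last; [apply (is_derive_opp (fun t => (psi a t - phi a t) / 2)), H1 |].
    unfold opp; simpl. rewrite (Rplus_comm (psi a b)). ring.
  - apply (is_derive_ext (fun t => (psi t b + phi t b) / 2));
      [intros t; simpl; field |].
    evar_last; [exact H2 |].
    replace ((phi a b - psi a b) / 2) with (- ((psi a b - phi a b) / 2)) by field.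
    rewrite sin_neg. field. exact Hl.
Qed.

Lemma characteristic_angle_Backlund (U V W : R * R -> Prop)
  (z alpha beta phi psi X Y : R -> R -> R) :
  open U -> smooth_on U z -> (forall x y, U (x, y) -> 0 < z x y) ->
  constant_astigmatism_on U z -> is_alpha U z alpha -> is_beta U z beta ->
  (forall x y, U (x, y) -> phi x y =
     characteristic_angle (-1) z x y - characteristic_angle 1 z x y) ->
  (forall x y, U (x, y) -> psi x y = characteristic_angle 1 z x y +
     characteristic_angle (-1) z x y + 2 * PI) ->
  local_chart U alpha beta V W X Y ->
  Backlund 1 W (in_chart X Y phi) (in_chart X Y psi).
Proof.
  intros HU Hz Hpos Heq Ha Hb Hphi Hpsi Hch a b Hab.
  pose proof Hch as (_ & OW & HVU & _ & HW).
  assert (HWU : forall u v, W (u, v) -> U (X u v, Y u v)).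
  { intros u v Huv. apply HVU, (HW u v Huv). }
  destruct (characteristic_chart_derive U V W z alpha beta X Y a b HU Hz Hpos
    Ha Hb Hch Hab) as [[DXa DYa] [DXb DYb]].
  pose proof (HWU a b Hab) as Hxy.
  pose proof (Hpos _ _ Hxy) as Hzp.
  destruct (characteristic_angle_sin_cos 1 z _ _ Hzp) as [S1 _].
  destruct (characteristic_angle_sin_cos (-1) z _ _ Hzp) as [S2 _].
  rewrite <- Rplus_z_characteristic in S1.
  rewrite <- Rminus_z_characteristic in S2.
  pose proof (Rplus_z_pos z _ _ Hzp); pose proof (Rminus_z_pos z _ _ Hzp).
  assert (Hadd : forall (f : R -> R) (t l : R), is_derive f t l ->
    is_derive (fun v => f v + PI) t l).
  { intros f t l Df. evar_last.
    - apply (is_derive_plus f (fun _ => PI) t l 0 Df). apply @is_derive_const.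
    - apply Rplus_0_r. }
  pose proof (open_locally_2d W a b OW Hab) as Hloc.
  unfold in_chart. rewrite (Hphi _ _ Hxy), (Hpsi _ _ Hxy).
  split.
  - apply (is_derive_ext_loc
      (fun t => characteristic_angle 1 z (X a t) (Y a t) + PI)).
    { apply locally_2d_1d_const_x in Hloc. revert Hloc. apply filter_imp.
      intros t Ht. rewrite (Hphi _ _ (HWU _ _ Ht)), (Hpsi _ _ (HWU _ _ Ht)).
      simpl; field. }
    apply Hadd. evar_last.
    { apply (characteristic_angle_along 1 U z (fun t => X a t) (fun t => Y a t) b
        (2 * z (X a b) (Y a b) / Rminus_z z (X a b) (Y a b))); trivial. ring. }
    replace ((_ + _) / 2) with (characteristic_angle (-1) z (X a b) (Y a b) + PI)
      by field.
    rewrite neg_sin, S2. field. lra.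
  - apply (is_derive_ext_loc
      (fun t => characteristic_angle (-1) z (X t b) (Y t b) + PI)).
    { apply locally_2d_1d_const_y in Hloc. revert Hloc. apply filter_imp.
      intros t Ht. rewrite (Hphi _ _ (HWU _ _ Ht)), (Hpsi _ _ (HWU _ _ Ht)).
      simpl; field. }
    apply Hadd. evar_last.
    { apply (characteristic_angle_along (-1) U z (fun t => X t b) (fun t => Y t b)
        a (2 * z (X a b) (Y a b) / Rplus_z z (X a b) (Y a b))); trivial. ring. }
    replace ((_ - _) / 2) with (characteristic_angle 1 z (X a b) (Y a b) + PI)
      by field.
    rewrite neg_sin, S1. field. lra.
Qed.

Theorem proposition7 (U : R * R -> Prop) (z alpha beta phi1 phi2 : R -> R -> R)
  (U_open : open U)
  (U_sc : simply_connected U)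
  (z_smooth : smooth_on U z)
  (z_pos : forall x y, U (x, y) -> 0 < z x y)
  (z_eq : constant_astigmatism_on U z)
  (F1_z : F1_rel U z alpha beta phi1)
  (F2_z : F2_rel U z alpha beta phi2) :
  local_coordinates U alpha beta /\
  exists k1 k2 : Z,
    Backlund_on 1 U alpha beta (shift_2PI k1 phi1) (shift_2PI k2 phi2) /\
    Backlund_on (-1) U alpha beta (shift_2PI k2 phi2) (shift_2PI k1 phi1).
Proof.
  destruct F1_z as (Ha & Hb & Hphi1); destruct F2_z as (_ & _ & Hphi2).
  destruct U_sc as [U_pc _].
  assert (Cz : forall x y, U (x, y) -> continuity_2d_pt z x y)
    by (intros; now apply (smooth_on_continuity U)).
  split.
  - apply (opposed_partials_local_coordinates U alpha beta _ _ _ _ U_open Ha Hb).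
    + intros x y Hxy. pose proof (z_pos x y Hxy) as Hz.
      pose proof (Rplus_z_pos z x y Hz); pose proof (Rminus_z_pos z x y Hz).
      pose proof (pow_lt _ 2 Hz).
      repeat split; try apply Ropp_lt_gt_0_contravar; apply Rdiv_lt_0_compat; lra.
    + intros x y Hxy. pose proof (z_pos x y Hxy) as Hz.
      split; (apply continuity_2d_pt_div; [| | lra]);
        try (apply continuity_2d_pt_mult; [apply continuity_2d_pt_const | auto]).
      * now apply (Rplus_z_continuity U).
      * now apply (Rminus_z_continuity U).
  - assert (Ct : forall s x y, U (x, y) ->
      continuity_2d_pt (characteristic_angle s z) x y)
      by (intros; apply (characteristic_angle_continuity s U); auto).
    destruct (equal_up_to_shift_2PI U phi1 (fun x y =>
      characteristic_angle (-1) z x y - characteristic_angle 1 z x y) U_pc)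
      as [k1 H1].
    { intros x y Hxy; split.
      - now apply (smooth_on_continuity U); [apply Hphi1 |].
      - apply continuity_2d_pt_minus; now apply Ct. }
    { intros; apply (is_phi1_characteristic U); auto. }
    destruct (equal_up_to_shift_2PI U phi2 (fun x y => characteristic_angle 1 z x y
      + characteristic_angle (-1) z x y + 2 * PI) U_pc) as [k2 H2].
    { intros x y Hxy; split.
      - now apply (smooth_on_continuity U); [apply Hphi2 |].
      - apply continuity_2d_pt_plus; [| apply continuity_2d_pt_const].
        apply continuity_2d_pt_plus; now apply Ct. }
    { intros; apply (is_phi2_characteristic U); auto. }
    assert (HB : Backlund_on 1 U alpha beta (shift_2PI k1 phi1) (shift_2PI k2 phi2)).
    { intros V W X Y Hch.
      apply (characteristic_angle_Backlund U V W z alpha beta); trivial;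
        intros x y Hxy; symmetry; auto. }
    exists k1, k2. split; [exact HB |].
    intros V W X Y Hch. apply (Backlund_swap 1); [lra |]. now apply (HB V).
Qed.
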